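(* (1) If $\ell\mathsf{IKt}2\vdash A$ then $\mathsf{IKt}2\vdash A$. (2) If $\ell\mathsf{Kt}2\vdash A$ then $\mathsf{Kt}2\vdash A$.
   Context: Formulas: $A ::= P \mid X \mid A\to B \mid \Box A \mid \blacksquare A \mid \forall X A$, with $\bot := \forall XX$, $\neg A := A\to\bot$, $\Diamond A := \forall X(\Box(A\to\blacksquare X)\to X)$, backward diamond $\Diamond^{\bullet}A := \forall X(\blacksquare(A\to\Box X)\to X)$. $\mathsf{IKt}2$: second-order intuitionistic propositional logic (with full comprehension $\forall XA\to A[C/X]$, modus ponens, generalisation with fresh propositional symbol), distribution axioms $\Box(A\to B)\to\Box A\to\Box B$, $\Box(A\to B)\to\Diamond A\to\Diamond B$, $\blacksquare(A\to B)\to\blacksquare A\to\blacksquare B$, $\blacksquare(A\to B)\to\Diamond^{\bullet}A\to\Diamond^{\bullet}B$, necessitation for $\Box$ and $\blacksquare$, tense axioms $\Diamond^{\bullet}\Box A\to A$, $A\to\Box\Diamond^{\bullet}A$, $\Diamond\blacksquare A\to A$, $A\to\blacksquare\Diamond A$; $\mathsf{Kt}2 := \mathsf{IKt}2+(\neg\neg A\to A)$. Labelled sequents have the form $\mathcal{R}\mid\Gamma\Rightarrow\Delta$ with $\mathcal{R}$ a set of relational atoms $vRw$ between world labels and $\Gamma,\Delta$ multisets of labelled formulas $v:A$. $\ell\mathsf{Kt}2$ has rules: identity $\mathcal{R}\mid v:A\Rightarrow v:A$; cut; left/right weakening and contraction; $\to$-left (from $\mathcal{R}\mid\Gamma\Rightarrow\Delta,v:A$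 and $\mathcal{R}\mid\Gamma',v:B\Rightarrow\Delta'$ infer $\mathcal{R}\mid\Gamma,\Gamma',v:A\to B\Rightarrow\Delta,\Delta'$); $\to$-right (from $\mathcal{R}\mid\Gamma,v:A\Rightarrow\Delta,v:B$ infer $\mathcal{R}\mid\Gamma\Rightarrow\Delta,v:A\to B$); $\forall$-left (from $v:A[C/X]$ on the left, any formula $C$, infer $v:\forall XA$ on the left); $\forall$-right (from $v:A[P/X]$ on the right, $P$ fresh, infer $v:\forall XA$); $\Box$-left (with $vRw\in\mathcal{R}$, from $w:A$ on the left infer $v:\Box A$ on the left); $\Box$-right (from $\mathcal{R},vRw\mid\Gamma\Rightarrow\Delta,w:A$ with $w$ fresh infer $\mathcal{R}\mid\Gamma\Rightarrow\Delta,v:\Box A$); $\blacksquare$-left (with $uRv\in\mathcal{R}$, from $u:A$ on the left infer $v:\blacksquare A$ on the left); $\blacksquare$-right (from $\mathcal{R},uRv\mid\Gamma\Rightarrow\Delta,u:A$ with $u$ fresh infer $\mathcal{R}\mid\Gamma\Rightarrow\Delta,v:\blacksquare A$). $\ell\mathsf{IKt}2$ is the restriction of $\ell\mathsf{Kt}2$ to sequents with exactly one labelled formula on the right. $\mathsf{L}\vdash A$ means $\mathsf{L}$ proves $\emptyset\mid\emptyset\Rightarrow v:A$. *)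

(* Defs.v *)
From Stdlib Require List.
From HB Require Import structures.
From mathcomp Require Import all_boot.
From mathcomp Require Import finmap multiset.

Set Implicit Arguments.
Unset Strict Implicit.
Unset Printing Implicit Defensive.

Local Open Scope fset_scope.
Local Open Scope mset_scope.

(** * Formulas *)

(** Propositional symbols [P] are names; propositional variables [X] are de
    Bruijn indices bound by [All]. *)
Inductive form : Type :=
| Sym of nat
| Var of nat
| Imp of form & form
| Box of form
| BBox of form
| All of form.

Fixpoint form_encode (A : form) : GenTree.tree nat :=
  match A with
  | Sym p => GenTree.Node 0 [:: GenTree.Leaf p]
  | Var n => GenTree.Node 1 [:: GenTree.Leaf n]
  | Imp A B => GenTree.Node 2 [:: form_encode A; form_encode B]
  | Box A => GenTree.Node 3 [:: form_encode A]
  | BBox A => GenTree.Node 4 [:: form_encode A]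
  | All A => GenTree.Node 5 [:: form_encode A]
  end.

Fixpoint form_decode (t : GenTree.tree nat) : option form :=
  match t with
  | GenTree.Node 0 [:: GenTree.Leaf p] => Some (Sym p)
  | GenTree.Node 1 [:: GenTree.Leaf n] => Some (Var n)
  | GenTree.Node 2 [:: t; u] =>
      if (form_decode t, form_decode u) is (Some A, Some B)
      then Some (Imp A B) else None
  | GenTree.Node 3 [:: t] => omap Box (form_decode t)
  | GenTree.Node 4 [:: t] => omap BBox (form_decode t)
  | GenTree.Node 5 [:: t] => omap All (form_decode t)
  | _ => None
  end.

Lemma form_encodeK : pcancel form_encode form_decode.
Proof. by elim=> //= [A -> B ->|A ->|A ->|A ->]. Qed.

HB.instance Definition _ := Countable.copy form (pcan_type form_encodeK).

Fixpoint shift (c : nat) (A : form) : form :=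
  match A with
  | Sym p => Sym p
  | Var n => Var (if n < c then n else n.+1)
  | Imp A B => Imp (shift c A) (shift c B)
  | Box A => Box (shift c A)
  | BBox A => BBox (shift c A)
  | All A => All (shift c.+1 A)
  end.

(** Replaces index [k] by [C] and lowers the indices above [k], as the
    binder of [k] is removed. *)
Fixpoint subst (k : nat) (C A : form) : form :=
  match A with
  | Sym p => Sym p
  | Var n => if n < k then Var n else if n == k then C else Var n.-1
  | Imp A B => Imp (subst k C A) (subst k C B)
  | Box A => Box (subst k C A)
  | BBox A => BBox (subst k C A)
  | All A => All (subst k.+1 (shift 0 C) A)
  end.

(** [inst A C] is A[C/X], where [A] is the body of [All A], i.e. of ∀X A. *)
Definition inst (A C : form) : form := subst 0 C A.

Fixpoint occurs (p : nat) (A : form) : bool :=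
  match A with
  | Sym q => p == q
  | Var _ => false
  | Imp A B => occurs p A || occurs p B
  | Box A | BBox A | All A => occurs p A
  end.

Definition Bot : form := All (Var 0).
Definition Neg (A : form) : form := Imp A Bot.
Definition Dia (A : form) : form :=
  All (Imp (Box (Imp (shift 0 A) (BBox (Var 0)))) (Var 0)).
Definition BDia (A : form) : form :=
  All (Imp (BBox (Imp (shift 0 A) (Box (Var 0)))) (Var 0)).

(** * Axiomatic systems *)

Inductive IKt2_axiom : form -> Prop :=
| ax_K A B : IKt2_axiom (Imp A (Imp B A))
| ax_S A B C :
    IKt2_axiom (Imp (Imp A (Imp B C)) (Imp (Imp A B) (Imp A C)))
| ax_comprehension A C : IKt2_axiom (Imp (All A) (inst A C))
(* ∀X(A → B) → A → ∀X B for X not free in A, which [shift 0 A] expresses *)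
| ax_all_imp A B :
    IKt2_axiom (Imp (All (Imp (shift 0 A) B)) (Imp A (All B)))
| ax_box_box A B :
    IKt2_axiom (Imp (Box (Imp A B)) (Imp (Box A) (Box B)))
| ax_box_dia A B :
    IKt2_axiom (Imp (Box (Imp A B)) (Imp (Dia A) (Dia B)))
| ax_bbox_bbox A B :
    IKt2_axiom (Imp (BBox (Imp A B)) (Imp (BBox A) (BBox B)))
| ax_bbox_bdia A B :
    IKt2_axiom (Imp (BBox (Imp A B)) (Imp (BDia A) (BDia B)))
| ax_bdia_box A : IKt2_axiom (Imp (BDia (Box A)) A)
| ax_box_bdia A : IKt2_axiom (Imp A (Box (BDia A)))
| ax_dia_bbox A : IKt2_axiom (Imp (Dia (BBox A)) A)
| ax_bbox_dia A : IKt2_axiom (Imp A (BBox (Dia A))).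

Inductive Kt2_axiom : form -> Prop :=
| ax_IKt2 A : IKt2_axiom A -> Kt2_axiom A
| ax_dne A : Kt2_axiom (Imp (Neg (Neg A)) A).

Inductive hilbert (Ax : form -> Prop) : form -> Prop :=
| hilbert_ax A : Ax A -> hilbert Ax A
| hilbert_mp A B : hilbert Ax (Imp A B) -> hilbert Ax A -> hilbert Ax B
| hilbert_gen A p :
    ~~ occurs p A -> hilbert Ax (inst A (Sym p)) -> hilbert Ax (All A)
| hilbert_nec_box A : hilbert Ax A -> hilbert Ax (Box A)
| hilbert_nec_bbox A : hilbert Ax A -> hilbert Ax (BBox A).

Definition IKt2 : form -> Prop := hilbert IKt2_axiom.
Definition Kt2 : form -> Prop := hilbert Kt2_axiom.

(** * Labelled systems *)

Definition label := nat.

(** [(v, w)] is the relational atom vRw. *)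
Definition relatom := (label * label)%type.

(** [(v, A)] is the labelled formula v : A. *)
Definition lform := (label * form)%type.

Record sequent := Sequent {
  sq_rel : {fset relatom};
  sq_ante : {mset lform};
  sq_succ : {mset lform}
}.

Notation "R ∣ G ⇒ D" := (Sequent R G D)
  (at level 100, G at level 99, D at level 99).

Definition fresh_sym (p : nat) (G : {mset lform}) : Prop :=
  forall v A, (v, A) \in G -> ~~ occurs p A.

Definition fresh_label_rel (w : label) (R : {fset relatom}) : Prop :=
  forall u v, (u, v) \in R -> w != u /\ w != v.

Definition fresh_label (w : label) (G : {mset lform}) : Prop :=
  forall v A, (v, A) \in G -> w != v.

(** [lKt2_rule ps S]: [S] follows from the premises [ps] by one inference
    step. *)
Inductive lKt2_rule : seq sequent -> sequent -> Prop :=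
| r_id R v A :
    lKt2_rule [::] (R ∣ [mset (v, A)] ⇒ [mset (v, A)])
| r_cut R G G' D D' v A :
    lKt2_rule [:: (R ∣ G ⇒ (v, A) +` D); (R ∣ (v, A) +` G' ⇒ D')]
              (R ∣ G `+` G' ⇒ D `+` D')
| r_weak_l R G D v A :
    lKt2_rule [:: (R ∣ G ⇒ D)] (R ∣ (v, A) +` G ⇒ D)
| r_weak_r R G D v A :
    lKt2_rule [:: (R ∣ G ⇒ D)] (R ∣ G ⇒ (v, A) +` D)
| r_contr_l R G D v A :
    lKt2_rule [:: (R ∣ (v, A) +` ((v, A) +` G) ⇒ D)]
              (R ∣ (v, A) +` G ⇒ D)
| r_contr_r R G D v A :
    lKt2_rule [:: (R ∣ G ⇒ (v, A) +` ((v, A) +` D))]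
              (R ∣ G ⇒ (v, A) +` D)
| r_imp_l R G G' D D' v A B :
    lKt2_rule [:: (R ∣ G ⇒ (v, A) +` D); (R ∣ (v, B) +` G' ⇒ D')]
              (R ∣ (v, Imp A B) +` (G `+` G') ⇒ D `+` D')
| r_imp_r R G D v A B :
    lKt2_rule [:: (R ∣ (v, A) +` G ⇒ (v, B) +` D)]
              (R ∣ G ⇒ (v, Imp A B) +` D)
| r_all_l R G D v A C :
    lKt2_rule [:: (R ∣ (v, inst A C) +` G ⇒ D)]
              (R ∣ (v, All A) +` G ⇒ D)
| r_all_r R G D v A p :
    fresh_sym p G -> fresh_sym p D -> ~~ occurs p A ->
    lKt2_rule [:: (R ∣ G ⇒ (v, inst A (Sym p)) +` D)]
              (R ∣ G ⇒ (v, All A) +` D)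
| r_box_l R G D v w A :
    (v, w) \in R ->
    lKt2_rule [:: (R ∣ (w, A) +` G ⇒ D)] (R ∣ (v, Box A) +` G ⇒ D)
| r_box_r R G D v w A :
    fresh_label_rel w R -> fresh_label w G -> fresh_label w D -> w != v ->
    lKt2_rule [:: (((v, w) |` R)%fset ∣ G ⇒ (w, A) +` D)]
              (R ∣ G ⇒ (v, Box A) +` D)
| r_bbox_l R G D u v A :
    (u, v) \in R ->
    lKt2_rule [:: (R ∣ (u, A) +` G ⇒ D)] (R ∣ (v, BBox A) +` G ⇒ D)
| r_bbox_r R G D u v A :
    fresh_label_rel u R -> fresh_label u G -> fresh_label u D -> u != v ->
    lKt2_rule [:: (((u, v) |` R)%fset ∣ G ⇒ (u, A) +` D)]
              (R ∣ G ⇒ (v, BBox A) +` D).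

Definition single_succ (S : sequent) : Prop :=
  exists v A, sq_succ S = [mset (v, A)].

Definition lIKt2_rule (ps : seq sequent) (S : sequent) : Prop :=
  [/\ lKt2_rule ps S, single_succ S & forall T, List.In T ps -> single_succ T].

Inductive derivable (rule : seq sequent -> sequent -> Prop) : sequent -> Prop :=
| derivable_step ps S :
    rule ps S -> (forall T, List.In T ps -> derivable rule T) ->
    derivable rule S.

(** The label is immaterial: derivability is invariant under renaming. *)
Definition proves (rule : seq sequent -> sequent -> Prop) (A : form) : Prop :=
  exists v, derivable rule (fset0 ∣ mset0 ⇒ [mset (v, A)]).

Definition lIKt2 : form -> Prop := proves lIKt2_rule.
Definition lKt2 : form -> Prop := proves lKt2_rule.

(* Main.v *)
From mathcomp Require Import all_boot.
From mathcomp Require Import finmap multiset.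
Require Import Defs.

Set Implicit Arguments.
Unset Strict Implicit.
Unset Printing Implicit Defensive.

Local Open Scope fset_scope.
Local Open Scope mset_scope.

(** Given a set of relational atoms, call a family of formulas [phi]
    indexed by labels coherent if every atom vRw satisfies
    [phi v -> Dia (phi w)] and [phi w -> BDia (phi v)]. A sequent is valid if
    in every coherent family whose members entail the antecedent formulas at their
    labels, some member entails a succedent formula at its label; classically,
    the members may also be assumed to entail the negated succedent, and it is
    enough that one of them is inconsistent. All rules preserve validity as
    long as the atoms form a forest, which backward proof search from a single
    formula guarantees: over a forest, the member at one label can be
    strengthened at will and the change propagated to the other labels.
    Validity also quantifies over renamings of propositional symbols, so that
    the eigensymbol of ∀-right can be kept apart from the family. *)

(** * Shifting, fresh symbols and renaming of symbols *)

Lemma occurs_shift p c A : occurs p (shift c A) = occurs p A.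
Proof. by elim: A c => //= A IHA B IHB c; rewrite IHA IHB. Qed.

Lemma subst_shift k C A : subst k C (shift k A) = A.
Proof.
elim: A k C => //= [n|A IHA B IHB|A IHA|A IHA|A IHA] k C; rewrite ?IHA ?IHB //.
case: (ltnP n k) => [->//|kn].
by rewrite ltnNge (leqW kn) /= eqn_leq ltnNge kn.
Qed.

Fixpoint sym_bound (A : form) : nat :=
  match A with
  | Sym p => p.+1
  | Var _ => 0
  | Imp A B => maxn (sym_bound A) (sym_bound B)
  | Box A | BBox A | All A => sym_bound A
  end.

Lemma occurs_sym_bound p A : occurs p A -> p < sym_bound A.
Proof.
elim: A => //= [q /eqP -> //|A IHA B IHB].
by rewrite leq_max => /orP[/IHA -> //|/IHB ->]; rewrite orbT.
Qed.

Lemma fresh_sym_exists A : exists p, ~~ occurs p A.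
Proof.
by exists (sym_bound A); apply/negP => /occurs_sym_bound; rewrite ltnn.
Qed.

Fixpoint rename (s : nat -> nat) (A : form) : form :=
  match A with
  | Sym p => Sym (s p)
  | Var n => Var n
  | Imp A B => Imp (rename s A) (rename s B)
  | Box A => Box (rename s A)
  | BBox A => BBox (rename s A)
  | All A => All (rename s A)
  end.

Lemma rename_id A : rename id A = A.
Proof. by elim: A => //= [A -> B ->|A ->|A ->|A ->]. Qed.

Lemma rename_shift s c A : rename s (shift c A) = shift c (rename s A).
Proof. by elim: A c => //= [A IHA B IHB|A IHA|A IHA|A IHA] c; rewrite IHA ?IHB. Qed.

Lemma rename_subst s k C A :
  rename s (subst k C A) = subst k (rename s C) (rename s A).
Proof.
elim: A k C => //= [n|A IHA B IHB|A IHA|A IHA|A IHA] k C;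
  rewrite ?IHA ?IHB ?rename_shift //.
by case: ifP => // _; case: ifP.
Qed.

Lemma eq_rename s t A :
  (forall p, occurs p A -> s p = t p) -> rename s A = rename t A.
Proof.
elim: A => //= [p|A IHA B IHB|A IHA|A IHA|A IHA] st; rewrite ?IHA ?IHB ?st //.
- by move=> p pB; apply: st; rewrite pB orbT.
- by move=> p pA; apply: st; rewrite pA.
Qed.

(** * Derived rules of the axiomatic systems *)

(** [true] selects the classical system, so that both halves of the theorem share one proof. *)
Definition axioms (b : bool) : form -> Prop :=
  if b then Kt2_axiom else IKt2_axiom.

Definition entails (b : bool) (A B : form) : Prop :=
  hilbert (axioms b) (Imp A B).

Section Hilbert.

Context {b : bool}.

Local Notation "⊢ A" := (hilbert (axioms b) A) (at level 70).
Local Notation "A ⊢ B" := (entails b A B) (at level 70).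

Lemma ikt2_axiom A : IKt2_axiom A -> ⊢ A.
Proof. by move=> axA; apply: hilbert_ax; rewrite /axioms; case: b => //; left. Qed.

Lemma entails_const A B : ⊢ A -> B ⊢ A.
Proof. by apply: hilbert_mp; apply/ikt2_axiom/ax_K. Qed.

Lemma entails_mp C A B : C ⊢ Imp A B -> C ⊢ A -> C ⊢ B.
Proof.
move=> CAB; apply: hilbert_mp; apply: hilbert_mp CAB.
exact/ikt2_axiom/ax_S.
Qed.

Lemma entails_refl A : A ⊢ A.
Proof.
by apply: (@entails_mp _ (Imp A A)); apply: ikt2_axiom; apply: ax_K.
Qed.

Lemma entails_trans B A C : A ⊢ B -> B ⊢ C -> A ⊢ C.
Proof. by move=> AB BC; apply: (entails_mp _ AB); apply: entails_const. Qed.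

Lemma entails_weaken A B C : C ⊢ B -> C ⊢ Imp A B.
Proof. by move=> CB; apply: (entails_trans CB); apply/ikt2_axiom/ax_K. Qed.

Lemma entails_mp2 C D A B : C ⊢ Imp D (Imp A B) -> C ⊢ Imp D A -> C ⊢ Imp D B.
Proof.
by move=> CDAB; apply: entails_mp; apply: (entails_trans CDAB); apply/ikt2_axiom/ax_S.
Qed.

Lemma entails_flip C D A B : C ⊢ Imp D (Imp A B) -> C ⊢ Imp A (Imp D B).
Proof.
move=> CDAB; apply: (entails_mp2 (A := Imp D A)).
  by apply: entails_weaken; apply: (entails_trans CDAB); apply/ikt2_axiom/ax_S.
by apply/entails_const/ikt2_axiom/ax_K.
Qed.

Lemma entails_inst A C : All A ⊢ inst A C.
Proof. exact/ikt2_axiom/ax_comprehension. Qed.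

(** Generalisation is applied to the whole implication; [ax_all_imp] then moves [H] out of the
    quantifier. *)
Lemma entails_all H A p :
  ~~ occurs p H -> ~~ occurs p A -> H ⊢ inst A (Sym p) -> H ⊢ All A.
Proof.
move=> pH pA HA; apply: hilbert_mp (ikt2_axiom (ax_all_imp H A)) _.
apply: (@hilbert_gen _ _ p); first by rewrite /= occurs_shift negb_or pH.
by rewrite /inst /= subst_shift.
Qed.

Lemma bot_entails A : Bot ⊢ A.
Proof. exact: (entails_inst (Var 0) A). Qed.

(** Second-order encoding of conjunction, ∀X((A → B → X) → X). *)
Definition Conj A B :=
  All (Imp (Imp (shift 0 A) (Imp (shift 0 B) (Var 0))) (Var 0)).

Lemma conj_l A B : Conj A B ⊢ A.
Proof.
have := entails_inst (Imp (Imp (shift 0 A) (Imp (shift 0 B) (Var 0))) (Var 0)) A.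
rewrite /inst /= !subst_shift => AB.
by apply: entails_mp AB _; apply: entails_const; apply/ikt2_axiom/ax_K.
Qed.

Lemma conj_r A B : Conj A B ⊢ B.
Proof.
have := entails_inst (Imp (Imp (shift 0 A) (Imp (shift 0 B) (Var 0))) (Var 0)) B.
rewrite /inst /= !subst_shift => AB.
by apply: entails_mp AB _; apply/entails_const/entails_const/entails_refl.
Qed.

Lemma conj_pair A B : A ⊢ Imp B (Conj A B).
Proof.
set body := Imp (Imp (shift 0 A) (Imp (shift 0 B) (Var 0))) (Var 0).
have [p] := fresh_sym_exists (Imp A (Imp (shift 0 B) body)).
rewrite /= 2!negb_or => /andP[pA /andP[pB pbody]].
apply: entails_trans (ikt2_axiom (ax_all_imp B body)).
apply: (@entails_all _ _ p) => //; first by rewrite /= negb_or pB.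
rewrite /inst /= !subst_shift.
set D := Imp A (Imp B (Sym p)).
apply: entails_flip; apply: entails_mp2; last by apply/ikt2_axiom/ax_K.
exact/entails_const/entails_refl.
Qed.

Lemma entails_conj C A B : C ⊢ A -> C ⊢ B -> C ⊢ Conj A B.
Proof. by move=> CA; apply: entails_mp; apply: (entails_trans CA (conj_pair A B)). Qed.

Lemma entails_curry A B C : Conj A B ⊢ C -> A ⊢ Imp B C.
Proof. by move=> ABC; apply: entails_mp2 (conj_pair A B); do 2! apply: entails_const. Qed.

(** The direction [d] selects between the two converse modalities, so that
    [box d] is right adjoint to [dia (~~ d)]. *)
Definition box (d : bool) := if d then BBox else Box.
Definition dia (d : bool) := if d then BDia else Dia.

Lemma box_nec d A : ⊢ A -> ⊢ box d A.
Proof. by case: d; [apply: hilbert_nec_bbox|apply: hilbert_nec_box]. Qed.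

Lemma box_dia_imp d A B : box d (Imp A B) ⊢ Imp (dia d A) (dia d B).
Proof. by case: d; apply: ikt2_axiom; [apply: ax_bbox_bdia|apply: ax_box_dia]. Qed.

Lemma box_mono d A B : A ⊢ B -> box d A ⊢ box d B.
Proof.
move=> /(box_nec d); apply: hilbert_mp.
by case: d; apply: ikt2_axiom; [apply: ax_bbox_bbox|apply: ax_box_box].
Qed.

Lemma dia_mono d A B : A ⊢ B -> dia d A ⊢ dia d B.
Proof. by move=> /(box_nec d); apply/hilbert_mp/box_dia_imp. Qed.

Lemma dia_box d A : dia (~~ d) (box d A) ⊢ A.
Proof. by case: d; apply: ikt2_axiom; [apply: ax_dia_bbox|apply: ax_bdia_box]. Qed.

Lemma box_dia d A : A ⊢ box d (dia (~~ d) A).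
Proof. by case: d; apply: ikt2_axiom; [apply: ax_bbox_dia|apply: ax_box_bdia]. Qed.

(** By adjunction, since [Bot] entails [box (~~ d) Bot]. *)
Lemma dia_bot d : dia d Bot ⊢ Bot.
Proof.
have := dia_box (~~ d) Bot; rewrite negbK; apply: entails_trans.
exact/dia_mono/bot_entails.
Qed.

(** Neighbours of a point satisfying [C] see [C] when looking back: [C] entails
    [box d (dia (~~ d) C)], and this box is combined with [dia d B]. *)
Lemma dia_conj d A B C :
  A ⊢ dia d B -> A ⊢ C -> A ⊢ dia d (Conj B (dia (~~ d) C)).
Proof.
move=> leB leC; apply: entails_mp leB; apply: (entails_trans leC).
apply: (entails_trans (box_dia d C)).
apply: entails_trans (box_dia_imp d _ _); apply: box_mono.
apply: entails_curry; apply: entails_conj; [exact: conj_r|exact: conj_l].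
Qed.

End Hilbert.

(** * Coherent families *)

(** In [edge d v w], [w] is a point that [box d] at [v] speaks about; one argument thus covers both
    modalities. *)
Definition edge (d : bool) (v w : label) : relatom :=
  if d then (w, v) else (v, w).

Lemma edgeN d v w : edge (~~ d) v w = edge d w v.
Proof. by case: d. Qed.

(** Each atom attaches, in either direction, a label absent from the earlier atoms, so induction can
    detach leaves. *)
Inductive forest : {fset relatom} -> Prop :=
| forest0 : forest fset0
| forest_leaf d v w R :
    forest R -> fresh_label_rel w R -> w != v -> forest (edge d v w |` R)%fset.

Lemma fresh_label_edge w R d u v :
  fresh_label_rel w R -> edge d u v \in R -> (u != w) /\ (v != w).
Proof. by move=> wR; case: d => /= /wR[]; rewrite !(eq_sym w). Qed.

Definition coherent b (R : {fset relatom}) (phi : label -> form) : Prop :=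
  forall d v w, edge d v w \in R -> entails b (phi v) (dia d (phi w)).

Definition inconsistent b (phi : label -> form) : Prop :=
  exists v, entails b (phi v) Bot.

Definition update (phi : label -> form) w A v := if v == w then A else phi v.

Lemma update_eq phi w A : update phi w A w = A.
Proof. by rewrite /update eqxx. Qed.

Lemma update_neq phi w A v : v != w -> update phi w A v = phi v.
Proof. by rewrite /update => /negbTE ->. Qed.

(** The two entailments are the new atom read from either end; the old atoms do not mention [w]. *)
Lemma coherent_leaf b R d v w phi B :
  fresh_label_rel w R -> w != v -> coherent b R phi ->
  entails b (phi v) (dia d B) -> entails b B (dia (~~ d) (phi v)) ->
  coherent b (edge d v w |` R)%fset (update phi w B).
Proof.
move=> wR wv coh vB Bv d' x y; rewrite in_fset1U => /orP[/eqP exy|xyR].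
  have vw : v != w by rewrite eq_sym.
  by case: d d' vB Bv exy => [] [] /= vB Bv [-> ->]; rewrite update_eq update_neq.
have [xw yw] := fresh_label_edge wR xyR.
by rewrite !update_neq //; apply: coh xyR.
Qed.

(** Induction on the forest, detaching its last leaf. The final clause records that any
    inconsistency of the refined family stems from [phi] or [A]; the classical case relies on it. *)
Lemma coherent_refine b R phi v A :
  forest R -> coherent b R phi -> entails b A (phi v) ->
  exists psi, [/\ coherent b R psi, forall u, entails b (psi u) (phi u),
    psi v = A & inconsistent b psi -> inconsistent b phi \/ entails b A Bot].
Proof.
move=> fR; elim: fR v A => {R} [|d v w R _ IH wR wv] x A coh Ax.
  exists (update phi x A); split; rewrite ?update_eq //.
  - by move=> u; rewrite /update; case: eqP => [->|_] //; apply: entails_refl.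
  - move=> [u]; rewrite /update; case: eqP => [_|_] uBot; first by right.
    by left; exists u.
have cohR : coherent b R phi.
  by move=> d' u u' uu'; apply: coh; rewrite in_fset1U uu' orbT.
have vw : entails b (phi v) (dia d (phi w)) by apply: coh; rewrite fset1U1.
have wv' : entails b (phi w) (dia (~~ d) (phi v)).
  by apply: coh; rewrite edgeN fset1U1.
(* At the leaf itself, the demand [dia d A] is imposed on [v] and propagated by induction; then the
   leaf receives [A]. *)
have [exw|xw] := eqVneq x w.
  subst x; set B := Conj (phi v) (dia d A).
  have AB : entails b A (dia (~~ d) B).
    have := dia_conj (entails_trans Ax wv') (entails_refl A).
    by rewrite negbK.
  have [psi [coh' le psiv incons]] := IH v B cohR (conj_l _ _).
  exists (update psi w A); split; rewrite ?update_eq //.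
  - by apply: coherent_leaf => //; rewrite psiv //; apply: conj_r.
  - by move=> u; rewrite /update; case: eqP => [->|_].
  move=> [u]; rewrite /update; case: eqP => [_|_] uBot; first by right.
  have [|BBot] := incons (ex_intro _ u uBot); first by left.
  right; apply: (entails_trans AB).
  exact: (entails_trans (dia_mono _ BBot) (dia_bot _)).
have [psi [coh' le psix incons]] := IH x A cohR Ax.
(* Away from the leaf, the rest is refined first and the leaf then records what [v] has become. *)
set B := Conj (phi w) (dia (~~ d) (psi v)).
have vB : entails b (psi v) (dia d B).
  by apply: dia_conj (entails_refl _); apply: entails_trans vw.
exists (update psi w B); split; rewrite ?update_neq //.
- by apply: coherent_leaf => //; apply: conj_r.
- by move=> u; rewrite /update; case: eqP => [->|_] //; apply: conj_l.
move=> [u]; rewrite /update; case: eqP => [_|_] uBot; last first.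
  by apply: incons; exists u.
apply: incons; exists v; apply: (entails_trans vB).
exact: (entails_trans (dia_mono _ uBot) (dia_bot _)).
Qed.

(** * Validity *)

Definition satisfies b (s : nat -> nat) (phi : label -> form)
    (G : lform -> Prop) : Prop :=
  forall v A, G (v, A) -> entails b (phi v) (rename s A).

(** The inconsistent member may sit at a label not linked to [v]. *)
Definition forces b s phi (v : label) (A : form) : Prop :=
  entails b (phi v) (rename s A) \/ b /\ inconsistent b phi.

Definition consequence b R (G : lform -> Prop) v A : Prop :=
  forall s phi, coherent b R phi -> satisfies b s phi G -> forces b s phi v A.

(** Classically, the succedent [D] is moved to the left in negated form, which leaves a single
    conclusion to treat. *)
Definition assumptions (b : bool) (G D : {mset lform}) (x : lform) : Prop :=
  x \in G \/ exists v A, [/\ b, (v, A) \in D & x = (v, Neg A)].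

Definition valid b (S : sequent) : Prop :=
  forall s phi, coherent b (sq_rel S) phi ->
    satisfies b s phi (assumptions b (sq_ante S) (sq_succ S)) ->
    (exists v A, (v, A) \in sq_succ S /\ entails b (phi v) (rename s A)) \/
    b /\ inconsistent b phi.

Definition extend (x : lform) (G : lform -> Prop) (y : lform) : Prop :=
  y = x \/ G y.

Lemma satisfies_le b s phi psi G :
  satisfies b s phi G -> (forall u, entails b (psi u) (phi u)) ->
  satisfies b s psi G.
Proof. by move=> sat le u A /sat; apply: entails_trans. Qed.

Lemma satisfies_extend b s phi G v A :
  satisfies b s phi G -> entails b (phi v) (rename s A) ->
  satisfies b s phi (extend (v, A) G).
Proof. by move=> sat vA u B [[-> ->]|/sat]. Qed.

Lemma satisfies_sub b s phi (G G' : lform -> Prop) :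
  satisfies b s phi G' -> (forall x, G x -> G' x) -> satisfies b s phi G.
Proof. by move=> sat GG' u A /GG' /sat. Qed.

(** The family is refined at [v] by adding [A]; what the new member entails is then curried. *)
Lemma consequence_imp b R G v A B :
  forest R -> consequence b R (extend (v, A) G) v B ->
  consequence b R G v (Imp A B).
Proof.
move=> fR valB s phi coh sat.
have [psi [coh' le psiv incons]] :=
  coherent_refine fR coh (conj_l (phi v) (rename s A)).
have sat' : satisfies b s psi (extend (v, A) G).
  apply: satisfies_extend (satisfies_le sat le) _.
  by rewrite psiv; apply: conj_r.
case: (valB s psi coh' sat') => [|[hb /incons[|AB]]].
- by rewrite psiv => AB; left; apply: entails_curry.
- by right.
(* Here [phi v] refutes [A], so the implication holds vacuously. *)
- by left; apply: entails_curry; apply: (entails_trans AB (bot_entails _)).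
Qed.

Lemma consequence_all b R G v A p :
  (forall u B, G (u, B) -> ~~ occurs p B) -> ~~ occurs p A ->
  consequence b R G v (inst A (Sym p)) -> consequence b R G v (All A).
Proof.
move=> pG pA valA s phi coh sat.
have [q] := fresh_sym_exists (Imp (phi v) (rename s A)).
rewrite /= negb_or => /andP[qphi qA].
(* The eigensymbol [p] is sent to a symbol [q] absent from [phi v], which [s p] need not be. *)
pose t r := if r == p then q else s r.
have st B : ~~ occurs p B -> rename t B = rename s B.
  move=> pB; apply: eq_rename => r rB; rewrite /t; case: eqP => // rp.
  by rewrite rp (negbTE pB) in rB.
have sat' : satisfies b t phi G by move=> u B GB; rewrite st; [apply: sat|apply: pG GB].
case: (valA t phi coh sat') => [|]; last by right.
rewrite rename_subst /= st // /t eqxx => vA; left.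
exact: entails_all vA.
Qed.

(** A new leaf [w] is given [dia (~~ d) (phi v)]; if this entails [A], adjunction yields [box d A]
    at [v]. *)
Lemma consequence_box b R (G : lform -> Prop) d v w A :
  forest R -> fresh_label_rel w R -> (forall u B, G (u, B) -> w != u) ->
  w != v -> consequence b (edge d v w |` R)%fset G w A ->
  consequence b R G v (box d A).
Proof.
move=> fR wR wG wv valA s phi coh sat.
set B := dia (~~ d) (phi v).
have le_box : entails b B (rename s A) -> entails b (phi v) (rename s (box d A)).
  have -> : rename s (box d A) = box d (rename s A) by case: (d).
  move=> BA; apply: (entails_trans (box_dia d _)); exact: box_mono.
(* [phi v] need not entail the existence of a neighbour of [v], so it is first
   strengthened by [dia d B]; [B] still entails [dia (~~ d)] of the result. *)
have [psi [coh' le psiv incons]] :=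
  coherent_refine fR coh (conj_l (phi v) (dia d B)).
have BB : entails b B (dia (~~ d) (psi v)).
  rewrite psiv; have := dia_conj (entails_refl B) (entails_refl B).
  by rewrite negbK.
have coh2 : coherent b (edge d v w |` R)%fset (update psi w B).
  by apply: coherent_leaf => //; rewrite psiv; apply: conj_r.
have sat2 : satisfies b s (update psi w B) G.
  move=> u C GC; rewrite update_neq; last by rewrite eq_sym (wG _ _ GC).
  exact: (satisfies_le sat le).
have Bot_box : entails b B Bot -> entails b (phi v) (rename s (box d A)).
  by move=> BBot; apply: le_box; apply: (entails_trans BBot (bot_entails _)).
case: (valA s _ coh2 sat2) => [|[hb [u]]].
  by rewrite update_eq => BA; left; apply: le_box.
rewrite /update; case: eqP => [_ BBot|_ uBot].
  by left; apply: Bot_box.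
case: (incons (ex_intro _ u uBot)) => [|CBot]; first by right.
left; apply: Bot_box; apply: (entails_trans BB); rewrite psiv.
exact: (entails_trans (dia_mono _ CBot) (dia_bot _)).
Qed.

Lemma entails_box b R s phi d v w A :
  coherent b R phi -> edge d v w \in R ->
  entails b (phi v) (rename s (box d A)) -> entails b (phi w) (rename s A).
Proof.
move=> coh vw vA.
have wv : entails b (phi w) (dia (~~ d) (phi v)) by apply: coh; rewrite edgeN.
apply: (entails_trans wv); apply: (entails_trans (dia_mono _ vA)).
have -> : rename s (box d A) = box d (rename s A) by case: (d).
exact: dia_box.
Qed.

Lemma consequence_valid b R G D v A :
  consequence b R (assumptions b G D) v A -> valid b (R ∣ G ⇒ (v, A) +` D).
Proof.
move=> valA s phi /= coh sat; case: (valA s phi coh) => [|vA|]; last by right.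
  apply: satisfies_sub sat _ => x [|[u [B [hb BD ->]]]]; first by left.
  by right; exists u, B; rewrite in_mset1D BD orbT.
by left; exists v, A; rewrite mset1D1.
Qed.

(** Classically, [phi v] is refined by [Neg A], and the resulting inconsistency gives [A] by double
    negation elimination. Otherwise [D] is empty and [A] is the only possible conclusion. *)
Lemma valid_consequence b R G D v A :
  forest R -> (~~ b -> D = mset0) ->
  valid b (R ∣ G ⇒ (v, A) +` D) -> consequence b R (assumptions b G D) v A.
Proof.
case: b => [fR _|_ /(_ isT) ->] val s phi coh sat; last first.
  case: (val s phi coh) => [|[u [B []]]|[]] //; last first.
    by rewrite /= in_mset1D in_mset0 orbF => /eqP[-> ->]; left.
  by apply: satisfies_sub sat _ => x [|[u [B [hb BD ->]]]] //; left.
have [psi [coh' le psiv incons]] :=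
  coherent_refine fR coh (conj_l (phi v) (rename s (Neg A))).
have sat' : satisfies true s psi (assumptions true G ((v, A) +` D)).
  move=> u B [BG|[u' [C [_]]]]; first by apply: (satisfies_le sat le); left.
  rewrite in_mset1D => /orP[/eqP[-> ->]|CD] [-> ->].
    by rewrite psiv; apply: conj_r.
  by apply: (satisfies_le sat le); right; exists u', C.
(* Every succedent formula is now negated at its label, so entailing one of them is inconsistent. *)
have/incons : inconsistent true psi.
  case: (val s psi coh' sat') => [[u [B [/= BD uB]]]|[]] //.
  exists u; apply: entails_mp uB; apply: (sat' u (Neg B)).
  by right; exists u, B.
case=> [|vBot]; first by right.
left; apply: (entails_trans (entails_curry vBot)).
exact/hilbert_ax/ax_dne.
Qed.

(** * Soundness of the labelled systems *)

Lemma single_cons R G D v A :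
  single_succ (R ∣ G ⇒ (v, A) +` D) -> D = mset0.
Proof.
move=> [w [B /= /msetP eD]]; apply/msetP => x; rewrite mset0E.
have := eD (v, A); rewrite mset1DE msetnE eqxx; case: eqP => // vw _.
by have := eD x; rewrite mset1DE msetnE -vw; case: eqP => _ // [].
Qed.

Lemma satisfies_assumptions b s phi (G G' D D' : {mset lform}) :
  satisfies b s phi (assumptions b G D) -> {subset G' <= G} ->
  {subset D' <= D} -> satisfies b s phi (assumptions b G' D').
Proof.
move=> sat sG sD; apply: satisfies_sub sat _ => x [/sG|[u [B [hb /sD BD ->]]]].
  by left.
by right; exists u, B.
Qed.

Lemma satisfies_cons b s phi (G D : {mset lform}) v A :
  satisfies b s phi (assumptions b G D) -> entails b (phi v) (rename s A) ->
  satisfies b s phi (assumptions b ((v, A) +` G) D).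
Proof.
move=> sat vA; apply: satisfies_sub (satisfies_extend sat vA) _ => x.
case=> [|xD]; last by right; right.
by rewrite in_mset1D => /orP[/eqP|xG]; [left|right; left].
Qed.

Lemma fresh_sym_assumptions b G D p :
  fresh_sym p G -> fresh_sym p D ->
  forall u B, assumptions b G D (u, B) -> ~~ occurs p B.
Proof.
move=> pG pD u B [/pG //|[w [C [_ /pD pC [_ ->]]]]].
by rewrite /= orbF.
Qed.

Lemma fresh_label_assumptions b G D w :
  fresh_label w G -> fresh_label w D ->
  forall u B, assumptions b G D (u, B) -> w != u.
Proof. by move=> wG wD u B [/wG //|[v [C [_ /wD wC [-> _]]]]]. Qed.

Lemma valid_left b R (G D : {mset lform}) v A w B :
  (forall s phi, coherent b R phi -> entails b (phi v) (rename s A) ->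
     entails b (phi w) (rename s B)) ->
  valid b (R ∣ (w, B) +` G ⇒ D) -> valid b (R ∣ (v, A) +` G ⇒ D).
Proof.
move=> AB val s phi /= coh sat; apply: (val s phi coh) => /=.
have vA : entails b (phi v) (rename s A).
  by apply: sat; left; rewrite mset1D1.
apply: satisfies_cons (AB s phi coh vA).
by apply: satisfies_assumptions sat _ _ => // x; apply: mset1Dr.
Qed.

Lemma valid_box_left b R (G D : {mset lform}) d v w A :
  edge d v w \in R ->
  valid b (R ∣ (w, A) +` G ⇒ D) -> valid b (R ∣ (v, box d A) +` G ⇒ D).
Proof.
move=> vw; apply: valid_left => s phi coh.
by apply: entails_box vw.
Qed.

Lemma valid_box_right b R (G D : {mset lform}) d v w A :
  forest R -> (~~ b -> D = mset0) -> fresh_label_rel w R -> fresh_label w G ->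
  fresh_label w D -> w != v ->
  valid b ((edge d v w |` R)%fset ∣ G ⇒ (w, A) +` D) ->
  valid b (R ∣ G ⇒ (v, box d A) +` D).
Proof.
move=> fR D0 wR wG wD wv val; apply: consequence_valid.
apply: (consequence_box fR wR _ wv); first exact: fresh_label_assumptions.
by apply: valid_consequence val => //; apply: forest_leaf.
Qed.

Lemma valid_sub b R (G G' D D' : {mset lform}) :
  {subset G' <= G} -> {subset D' <= D} ->
  valid b (R ∣ G' ⇒ D') -> valid b (R ∣ G ⇒ D).
Proof.
move=> sG sD val s phi /= coh sat.
case: (val s phi coh); first exact: satisfies_assumptions sat sG sD.
  by move=> [v [A [/sD AD vA]]]; left; exists v, A.
by right.
Qed.

(** Serves cut, where both formulas agree, and →-left, where the implication in [G0] leads from one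
    to the other. *)
Lemma valid_cut b R (G0 G G' D D' : {mset lform}) v A w B :
  forest R -> (~~ b -> D = mset0) -> {subset G <= G0} -> {subset G' <= G0} ->
  (forall s phi, satisfies b s phi (assumptions b G0 (D `+` D')) ->
     entails b (phi v) (rename s A) -> entails b (phi w) (rename s B)) ->
  valid b (R ∣ G ⇒ (v, A) +` D) -> valid b (R ∣ (w, B) +` G' ⇒ D') ->
  valid b (R ∣ G0 ⇒ D `+` D').
Proof.
move=> fR D0 sG sG' AB valA valB s phi /= coh sat.
have sD : {subset D <= D `+` D'} by move=> x xD; rewrite in_msetD xD.
have sD' : {subset D' <= D `+` D'} by move=> x xD; rewrite in_msetD xD orbT.
have := valid_consequence fR D0 valA coh (satisfies_assumptions sat sG sD).
case=> [vA|]; last by right.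
have sat' := satisfies_assumptions sat sG' sD'.
case: (valB s phi coh (satisfies_cons sat' (AB s phi sat vA))); last by right.
by move=> [u [C [/sD' CD uC]]]; left; exists u, C.
Qed.

(** The forest condition passes from conclusion to premises: the atoms stay the same or gain a fresh
    leaf. *)
Lemma rule_valid b ps S :
  lKt2_rule ps S -> (~~ b -> forall T, List.In T ps -> single_succ T) ->
  (forall T, List.In T ps -> forest (sq_rel T) -> valid b T) ->
  forest (sq_rel S) -> valid b S.
Proof.
case=> {ps S} [R v A|R G G' D D' v A|R G D v A|R G D v A|R G D v A|R G D v A
  |R G G' D D' v A B|R G D v A B|R G D v A C|R G D v A p pG pD pA
  |R G D v w A vw|R G D v w A wR wG wD wv|R G D u v A uv|R G D u v A uR uG uD uv]
  /= single IH fR.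
- move=> s phi _ sat; left; exists v, A; rewrite /= in_mset1 eqxx; split=> //.
  by apply: sat; left; rewrite /= in_mset1.
- apply: valid_cut (IH _ (or_introl erefl) fR)
    (IH _ (or_intror (or_introl erefl)) fR) => //.
  + by move=> /single /(_ _ (or_introl erefl)) /single_cons.
  + by move=> x xG; rewrite in_msetD xG.
  + by move=> x xG; rewrite in_msetD xG orbT.
- by apply: valid_sub (IH _ (or_introl erefl) fR) => // x; apply: mset1Dr.
- by apply: valid_sub (IH _ (or_introl erefl) fR) => // x; apply: mset1Dr.
- apply: valid_sub (IH _ (or_introl erefl) fR) => // x.
  by rewrite !in_mset1D => /orP[->|].
- apply: valid_sub (IH _ (or_introl erefl) fR) => // x.
  by rewrite !in_mset1D => /orP[->|].
- apply: valid_cut (IH _ (or_introl erefl) fR)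
    (IH _ (or_intror (or_introl erefl)) fR) => //.
  + by move=> /single /(_ _ (or_introl erefl)) /single_cons.
  + by move=> x xG; rewrite in_mset1D in_msetD xG orbT.
  + by move=> x xG; rewrite in_mset1D in_msetD xG !orbT.
  + move=> s phi sat; apply: entails_mp; apply: (sat v (Imp A B)).
    by left; rewrite mset1D1.
- have D0 : ~~ b -> D = mset0.
    by move=> /single /(_ _ (or_introl erefl)) /single_cons.
  apply/consequence_valid/consequence_imp => //.
  have := valid_consequence fR D0 (IH _ (or_introl erefl) fR).
  move=> val s phi coh sat; apply: (val s phi coh).
  apply: satisfies_sub sat _ => x [|xD]; last by right; right.
  by rewrite in_mset1D => /orP[/eqP|xG]; [left|right; left].
- apply: valid_left (IH _ (or_introl erefl) fR) => s phi _ /=.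
  by rewrite /inst rename_subst => vA; apply: (entails_trans vA (entails_inst _ _)).
- have D0 : ~~ b -> D = mset0.
    by move=> /single /(_ _ (or_introl erefl)) /single_cons.
  apply: consequence_valid; apply: (consequence_all (p := p)) => //.
    exact: fresh_sym_assumptions.
  exact: valid_consequence (IH _ (or_introl erefl) fR).
- exact: (@valid_box_left _ _ _ _ false v w) (IH _ (or_introl erefl) fR).
- apply: (@valid_box_right _ _ _ _ false v w) => //.
    by move=> /single /(_ _ (or_introl erefl)) /single_cons.
  by apply: (IH _ (or_introl erefl)); apply: (@forest_leaf false).
- exact: (@valid_box_left _ _ _ _ true v u) (IH _ (or_introl erefl) fR).
- apply: (@valid_box_right _ _ _ _ true v u) => //.
    by move=> /single /(_ _ (or_introl erefl)) /single_cons.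
  by apply: (IH _ (or_introl erefl)); apply: (@forest_leaf true).
Qed.

Lemma derivable_valid b rule S :
  (forall ps T, rule ps T ->
     lKt2_rule ps T /\ (~~ b -> forall U, List.In U ps -> single_succ U)) ->
  derivable rule S -> forest (sq_rel S) -> valid b S.
Proof.
move=> sub; elim=> {S} ps S /sub[ruleS single] _ IH.
exact: rule_valid ruleS single IH.
Qed.

Lemma proves_hilbert b rule A :
  (forall ps T, rule ps T ->
     lKt2_rule ps T /\ (~~ b -> forall U, List.In U ps -> single_succ U)) ->
  proves rule A -> hilbert (axioms b) A.
Proof.
move=> sub [v /(derivable_valid sub) /(_ forest0) val].
have D0 : (v, A) +` mset0 = [mset (v, A)] by rewrite msetDC mset0D.
rewrite -D0 in val.
(* A constant family with a provable member, coherent because there are no atoms: what it entails is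
   provable. *)
pose T := Imp Bot Bot.
have TT : hilbert (axioms b) T := entails_refl Bot.
have [||vA|[_ [u TBot]]] := valid_consequence forest0 (fun=> erefl) val
  (s := id) (phi := fun=> T).
- by [].
- by move=> u B [|[w [C []]]] //; rewrite in_mset0.
- by rewrite rename_id in vA; apply: hilbert_mp vA TT.
- exact: hilbert_mp (bot_entails A) (hilbert_mp TBot TT).
Qed.

Theorem theorem7p1 :
  (forall A : form, lIKt2 A -> IKt2 A) /\ (forall A : form, lKt2 A -> Kt2 A).
Proof.
split=> A.
- by apply: (@proves_hilbert false) => ps T [ruleT _ single].
- by apply: (@proves_hilbert true).
Qed.
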